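(* Suppose $X$ is a compact Hausdorff space. The following are equivalent: (1) There is a nonzero function $g\in C(X)$ such that the map $T(f)=g\bar f$ is a local multiplication on $C(X)$. (2) There is a nonempty open $F_\sigma$ subset of $X$ that is an F-space.
   Context: $C(X)$ denotes the algebra of complex-valued continuous functions on $X$, and $C_R(X)$ the real-valued ones. A map $T$ on $C(X)$ is a local multiplication if for each $f\in C(X)$ there is $a_f\in C(X)$ with $T(f)=a_f f$. An $F_\sigma$ set is a countable union of closed sets. For a completely regular Hausdorff space $S$, a cozero-set in $S$ is a set of the form $\{s\in S: f(s)\neq 0\}$ with $f\in C(S)$. A completely regular Hausdorff space $S$ is an F-space if for every cozero-set $A$ in $S$, every bounded function in $C_R(A)$ extends to a bounded function in $C_R(S)$. Subsets of $X$ carry the subspace topology. *)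

(* Defs.v *)
From HB Require Import structures.
From mathcomp Require Import all_boot all_order all_algebra.
From mathcomp Require Import complex.
From mathcomp Require Import all_classical reals topology normedtype.
From mathcomp Require Import borel_hierarchy.

Set Implicit Arguments.
Unset Strict Implicit.
Unset Printing Implicit Defensive.

Import Order.TTheory GRing.Theory Num.Theory.
Import numFieldTopology.Exports numFieldNormedType.Exports.

Local Open Scope classical_set_scope.
Local Open Scope ring_scope.
Local Open Scope complex_scope.

(* The library puts no topology on [R[i]] itself; the alias [R[i]^o] carries the
   one defined by the modulus. *)
Definition CC (R : realType) (X : topologicalType) := continuousType X R[i]^o.
Definition CR (R : realType) (X : topologicalType) := continuousType X R.

Lemma conjc_continuous (R : realType) :
  continuous (@conjc R : R[i]^o -> R[i]^o).
Proof.
move=> z.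
apply: (proj2 (@cvgrPdist_lt R[i] R[i]^o _ _ (nbhs_filter z) conjc (conjc z))).
move=> e e0.
have := proj1 (@cvgrPdist_lt R[i] R[i]^o _ _ (nbhs_filter z) id z) cvg_id e e0.
apply: filterS => w /=; rewrite -(raddfB (@conjc R)).
suff -> : forall u : R[i], `|conjc u| = `|u| by [].
by move=> [a b]; simpc; rewrite sqrrN.
Qed.

Lemma mul_conj_continuous (R : realType) (X : topologicalType) (g f : CC R X) :
  continuous (fun x : X => (g x * (f x)^* : R[i]^o)).
Proof.
move=> x.
apply: (@cvgM R[i] X (nbhs x) _ g (fun x => (f x)^*)); first exact: cts_fun.
exact: (continuous_comp (@cts_fun _ _ f x) (@conjc_continuous R (f x))).
Qed.

Definition mul_conj (R : realType) (X : topologicalType) (g f : CC R X) :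
  CC R X := mkcts (@mul_conj_continuous R X g f).

Definition local_multiplication (R : realType) (X : topologicalType)
    (T : CC R X -> CC R X) : Prop :=
  forall f : CC R X, exists a : CC R X, forall x, T f x = a x * f x.

Definition cozero_set (R : realType) (S : topologicalType) (A : set S) : Prop :=
  exists f : CC R S, A = [set s | f s != 0].

(* A set used as a type, as in [CR R A], is [set_type A] with the subspace
   topology. *)
Definition F_space (R : realType) (S : topologicalType) : Prop :=
  [/\ completely_regular_space S, hausdorff_space S &
      forall A : set S, cozero_set R A ->
      forall h : CR R A, [bounded h a | a in [set: A]] ->
      exists2 k : CR R S, [bounded k s | s in [set: S]] &
        forall a : A, k (set_val a) = h a].

(* Main.v *)
Require Import Defs.
From mathcomp Require Import all_boot all_order all_algebra.
From mathcomp Require Import complex ring.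
From mathcomp Require Import interval_inference.
From mathcomp Require Import all_classical reals topology normedtype.
From mathcomp Require Import borel_hierarchy.

(** The link between the two sides is the cozero-set [U] of [g]: up to the
    factor [g], the multiplier of [f] has to be [conj f / f], a unimodular
    function that is continuous on the cozero-set of [f] only, and extending
    such functions from cozero-sets to [U] is what an F-space allows.

    From an F-space [U] to a multiplication.  In a normal space an open
    F-sigma set is the cozero-set of a continuous real function
    ([open_Fsigma_cozero]), which serves as [g].  Given [f], the real and
    imaginary parts of [conj f / f] are bounded and continuous on the
    cozero-set of [f] in [U], hence extend to bounded functions on [U].  The
    extension [k] need not extend further to [X], but [g k] does, by [0]
    outside [U] ([mul_valL_continuous]), and it is the multiplier of [f]
    ([F_space_local_multiplication]).

    From a multiplication to an F-space.  Let [U] be the cozero-set of [g] and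
    [h] a bounded real function on a cozero-set [A] of [U].  Choose a
    nonnegative continuous [w] on [X] whose cozero-set is [A], and such that
    [w h] extends by [0] to [X]; apply the hypothesis to [f = w (1 - i h)].
    The multiplier divided by [g] is continuous on [U] and equals
    [(1 + i h) / (1 - i h)], the Cayley transform of [h], on [A].  The inverse
    Cayley transform recovers [h] from it as long as the value [-1] is avoided,
    and the bound on [h] keeps the values on [A] uniformly away from [-1]; so
    [h] is, on [A], the restriction of a continuous function on [U]
    ([local_multiplication_F_space]). *)

Set Implicit Arguments.
Unset Strict Implicit.
Unset Printing Implicit Defensive.

Import Order.TTheory GRing.Theory Num.Theory.
Import numFieldTopology.Exports numFieldNormedType.Exports.

Local Open Scope classical_set_scope.
Local Open Scope ring_scope.

(** * Continuity of complex-valued functions *)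

Section ComplexContinuity.
Local Open Scope complex_scope.
Variable R : realType.

Lemma normc_ge_Im (z : R[i]) : `|complex.Im z|%:C <= `|z|.
Proof.
rewrite -normrN -ReiNIm (le_trans (normc_ge_Re _))// normrM.
by rewrite [`|'i%C|]normc_def /= expr0n expr1n add0r sqrtr1 mulr1.
Qed.

Lemma Re_continuous : continuous (@complex.Re R : R[i]^o -> R).
Proof.
move=> z; apply: (proj2 (@cvgrPdist_lt R R^o _ _ (nbhs_filter z) _ _)) => e e0.
have e0' : 0 < e%:C :> R[i] by rewrite ltcR.
have := proj1 (@cvgrPdist_lt R[i] R[i]^o _ _ (nbhs_filter z) id z) cvg_id _ e0'.
apply: filterS => w /=; rewrite -ltcR; apply: le_lt_trans.
by rewrite -(raddfB (@complex.Re R)); exact: normc_ge_Re.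
Qed.

Lemma Im_continuous : continuous (@complex.Im R : R[i]^o -> R).
Proof.
move=> z; apply: (proj2 (@cvgrPdist_lt R R^o _ _ (nbhs_filter z) _ _)) => e e0.
have e0' : 0 < e%:C :> R[i] by rewrite ltcR.
have := proj1 (@cvgrPdist_lt R[i] R[i]^o _ _ (nbhs_filter z) id z) cvg_id _ e0'.
apply: filterS => w /=; rewrite -ltcR; apply: le_lt_trans.
by rewrite -(raddfB (@complex.Im R)); exact: normc_ge_Im.
Qed.

Lemma gt0_complexP (e : R[i]) : 0 < e -> exists2 d : R, 0 < d & e = d%:C.
Proof. by case: e => a b; rewrite ltcE /= => /andP[/eqP -> a0]; exists a. Qed.

Lemma real_complex_continuous : continuous (real_complex R : R -> R[i]^o).
Proof.
move=> x; apply: (proj2 (@cvgrPdist_lt R[i] R[i]^o _ _ (nbhs_filter x) _ _)).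
(* the radii of balls in [R[i]^o] are complex numbers *)
move=> _ /gt0_complexP[e e0 ->].
have := proj1 (@cvgrPdist_lt R R^o _ _ (nbhs_filter x) id x) cvg_id _ e0.
apply: filterS => y /=.
by rewrite -rmorphB normc_def /= expr0n addr0 sqrtr_sqr ltcR.
Qed.

Variable S : topologicalType.

Lemma continuous_Re (f : S -> R[i]^o) :
  continuous f -> continuous (fun x => complex.Re (f x)).
Proof. by move=> cf x; exact: (continuous_comp (cf x) (@Re_continuous _)). Qed.

Lemma continuous_Im (f : S -> R[i]^o) :
  continuous f -> continuous (fun x => complex.Im (f x)).
Proof. by move=> cf x; exact: (continuous_comp (cf x) (@Im_continuous _)). Qed.

Lemma continuous_complex (u v : S -> R) :
  continuous u -> continuous v -> continuous (fun x => u x +i* v x : R[i]^o).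
Proof.
move=> cu cv.
have -> : (fun x => u x +i* v x : R[i]^o) =
    (fun x => (u x)%:C + 'i%C * (v x)%:C : R[i]^o).
  by apply/funext => x; rewrite [LHS]complexE.
move=> x; apply: (@cvgD R[i] R[i]^o).
  exact: (continuous_comp (cu x) (@real_complex_continuous _)).
apply: (@cvgM R[i] S (nbhs x) _ (fun=> 'i%C) (fun y => (v y)%:C)).
  exact: (@cvg_cst R[i]^o).
exact: (continuous_comp (cv x) (@real_complex_continuous _)).
Qed.

Lemma continuous_conj_div (f : CC R S) :
  (forall x, f x != 0) -> continuous (fun x => conjc (f x) / f x : R[i]^o).
Proof.
move=> f0 x.
apply: (@cvgM R[i] S (nbhs x) _ (fun y => conjc (f y)) (fun y => (f y)^-1)).
  exact: (continuous_comp (@cts_fun _ _ f x) (@conjc_continuous R (f x))).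
by apply: (@cvgV R[i]); [exact: f0|exact: cts_fun].
Qed.

End ComplexContinuity.

(** * Separation in subspaces *)

Section Subspaces.
Variables (R : realType) (X : topologicalType) (U : set X).

Lemma completely_regular_set_type :
  completely_regular_space X -> completely_regular_space U.
Proof.
move=> crX a B cB nBa.
have : open (~` B) by rewrite openC.
case=> W oW WB.
have nW : ~ (~` W) (set_val a).
  by rewrite notE; have : (~` B) a by []; rewrite -WB.
have /(uniform_separatorP (R := R))[f [cf f01 f0 f1]] :=
  crX (set_val a) (~` W) (open_closedC oW) nW.
apply/(uniform_separatorP (R := R)); exists (f \o set_val); split.
- by move=> x; apply: continuous_comp; [exact: initial_continuous|exact: cf].
- by move=> _ [x _ <-]; apply: f01; exists (set_val x).
- by move=> _ [x -> <-]; apply: f0; exists (set_val a).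
- move=> _ [x Bx <-]; apply: f1; exists (set_val x) => // Wx.
  by have : (~` B) x by rewrite -WB.
Qed.

Lemma hausdorff_set_type : hausdorff_space X -> hausdorff_space U.
Proof.
move=> hX p q pq; apply/val_inj/hX => A B nA nB.
have [|| x [Ax Bx]] := pq (set_val @^-1` A) (set_val @^-1` B).
- exact: initial_continuous.
- exact: initial_continuous.
by exists (set_val x).
Qed.

End Subspaces.

(** * Extension by zero *)

Section ExtensionByZero.
Variables (R : realType) (S : topologicalType).

Lemma valL_set_val (A : set S) (k : A -> R) (a : A) :
  'valL_0 k (set_val a) = k a.
Proof. exact: (congr1 (@^~ a) (valLK 0 k)). Qed.

(** At a point of [A] both factors are continuous, because [A] is open; at any
    other point [G] tends to [0] while the second factor stays bounded. *)
Lemma mul_valL_continuous (A : set S) (G : S -> R) (k : A -> R) (M : R) :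
  open A -> continuous G -> (forall x, ~ A x -> G x = 0) ->
  continuous k -> (forall a, `|k a| <= M) ->
  continuous (fun x => G x * 'valL_0 k x).
Proof.
move=> oA cG G0 ck kM x.
have [Ax|nAx] := pselect (A x).
  apply: cvgM; first exact: cG.
  have := proj2 (@subspace_valL_continuousP' S A R 0 k) ck.
  by rewrite continuous_open_subspace// => /(_ x); apply; exact: mem_set.
have M0 : 0 < `|M| + 1 by rewrite ltr_wpDl.
apply/cvgrPdist_lt => e e0; rewrite G0// mul0r.
have /cvgrPdist_lt/(_ _ (divr_gt0 e0 M0)) := cG x.
apply: filterS => y; rewrite G0// !sub0r !normrN normrM ltr_pdivlMr//.
have [Ay|/G0 ->] := pselect (A y); last by rewrite normr0 !mul0r.
apply: le_lt_trans; rewrite ler_wpM2l//.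
have -> : 'valL_0 k y = k (exist _ y (mem_set Ay)) by rewrite -valL_set_val.
by rewrite (le_trans (kM _))// (le_trans (ler_norm _))// lerDl.
Qed.

End ExtensionByZero.

(** * Cozero-sets *)

Section CozeroSets.
Variable R : realType.

Lemma natSinv_lt (e : R) : 0 < e -> exists n, n.+1%:R^-1 < e.
Proof.
move=> /posnumP[{}e].
by have [N _ /(_ N (leqnn N))] := near_infty_natSinv_lt e; exists N.
Qed.

Lemma cozero_set_real (S : topologicalType) (A : set S) :
  cozero_set R A -> exists G : S -> R,
    [/\ continuous G, forall x, 0 <= G x & A = [set x | G x != 0]].
Proof.
move=> [f ->]; have cf := @cts_fun _ _ f.
exists (fun x => `|complex.Re (f x)| + `|complex.Im (f x)|); split.
- move=> x; apply: cvgD; apply: cvg_norm.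
    exact: (continuous_Re cf).
  exact: (continuous_Im cf).
- by move=> x; rewrite addr_ge0.
- by apply/seteqP; split=> x /=; rewrite paddr_eq0// !normr_eq0 eq_complex.
Qed.

Lemma cozero_set_open (S : topologicalType) (A : set S) :
  cozero_set R A -> open A.
Proof.
move=> /cozero_set_real[G [cG _ ->]].
apply: (@open_comp _ _ G [set y | y != 0]) => [x _|]; first exact: cG.
exact: open_neq.
Qed.

Lemma cozero_set_Fsigma (S : topologicalType) (A : set S) :
  cozero_set R A -> Fsigma A.
Proof.
move=> /cozero_set_real[G [cG G0 ->]].
exists (fun n => [set x | n.+1%:R^-1 <= G x]).
  move=> n; apply: (@preimage_closed _ _ _ [set y : R | n.+1%:R^-1 <= y]).
    exact: in1W cG.
  exact: closed_ge.
apply/seteqP; split => [x /= Gx|x [n _ /=] Gx].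
  have [|N NG] := @natSinv_lt (G x); first by rewrite lt_neqAle eq_sym Gx G0.
  by exists N => //=; rewrite ltW.
by rewrite gt_eqF// (lt_le_trans _ Gx)// invr_gt0.
Qed.

Section VanishingSup.
Variables (X : topologicalType) (f : nat -> X -> R).
Hypothesis f_bounds : forall n x, 0 <= f n x <= n.+1%:R^-1.

Lemma has_sup_vanishing x : has_sup (range (f^~ x)).
Proof.
split; first by exists (f 0 x), 0.
exists 1 => _ [n _ <-]; have /andP[_ /le_trans] := f_bounds n x; apply.
by rewrite invf_le1// ler1n.
Qed.

Lemma le_sup_vanishing n x : f n x <= sup (range (f^~ x)).
Proof.
by apply: ub_le_sup; [case: (has_sup_vanishing x)|exists n].
Qed.

(** Up to any [e > 0], finitely many indices determine the supremum, the other
    terms being uniformly below [e]. *)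
Lemma continuous_sup_vanishing :
  (forall n, continuous (f n)) -> continuous (fun x => sup (range (f^~ x))).
Proof.
move=> cf.
have close e x y N : 0 < e -> N.+1%:R^-1 < e ->
    (forall i : 'I_N, `|f i x - f i y| < e) ->
    sup (range (f^~ x)) <= sup (range (f^~ y)) + e.
  move=> e0 Ne fxy; apply: ge_sup; first by case: (has_sup_vanishing x).
  move=> _ [n _ <-]; have [nN|Nn] := ltnP n N.
    apply: (@le_trans _ _ (f n y + e)); last by rewrite lerD2r le_sup_vanishing.
    rewrite -lerBlDl (le_trans (ler_norm _))// ltW//.
    exact: (fxy (Ordinal nN)).
  apply: (@le_trans _ _ e).
    have /andP[_ /le_trans] := f_bounds n x; apply; rewrite (le_trans _ (ltW Ne))//.
    by rewrite lef_pV2 ?posrE// ler_nat ltnS.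
  rewrite lerDr (le_trans _ (le_sup_vanishing 0 y))//.
  by case/andP: (f_bounds 0 y).
move=> x; apply/cvgrPdist_le => e e0.
have [N Ne] := natSinv_lt e0.
have : \forall y \near x, forall i : 'I_N, `|f i x - f i y| < e.
  apply: filter_forall => i.
  exact: (proj1 (@cvgrPdist_lt R R^o _ _ (nbhs_filter x) _ _) (cf i x) _ _).
apply: filterS => y fxy; rewrite ler_distl; apply/andP; split.
  rewrite lerBlDr; apply: (close _ _ _ N) => // i; rewrite distrC; exact: fxy.
exact: (close _ _ _ N).
Qed.

End VanishingSup.

(** Separate each closed piece [F n] from the complement of [U] by a Urysohn
    function; the supremum of these functions, damped by [1 / (n + 1)] to keep
    it continuous, is positive exactly on the union of the pieces. *)
Lemma open_Fsigma_cozero (X : topologicalType) (U : set X) :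
  normal_space X -> open U -> Fsigma U ->
  exists2 G : X -> R, continuous G & forall x, U x <-> G x != 0.
Proof.
move=> nX oU [F cF UF].
have FU n : F n `&` ~` U = set0.
  by apply/disjoints_subset; rewrite setCK UF; exact: bigcup_sup.
have /choice[f fP] : forall n, exists f : X -> R, [/\ continuous f,
    range f `<=` `[0, 1], f @` (~` U) `<=` [set 0] & f @` F n `<=` [set 1]].
  move=> n; apply/(uniform_separatorP (R := R)).
  apply: (proj1 (@normal_separatorP R X) nX) => //; first exact: open_closedC.
  by rewrite setIC.
pose u n x := f n x / n.+1%:R.
have ub n x : 0 <= u n x <= n.+1%:R^-1.
  have [_ /(_ (f n x)) /= f01 _ _] := fP n.
  have /andP[f0 f1] : 0 <= f n x <= 1 by have := f01 (imageT _ _); rewrite in_itv.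
  by rewrite /u divr_ge0//= ler_piMl.
exists (fun x => sup (range (u^~ x))).
  apply: continuous_sup_vanishing => // n x; apply: cvgM; last exact: cvg_cst.
  by have [+ _ _ _] := fP n; exact.
move=> x; split => [Ux|].
  have [n _ Fnx] : (\bigcup_i F i) x by rewrite -UF.
  rewrite gt_eqF//; apply: (lt_le_trans _ (le_sup_vanishing ub n x)).
  have [_ _ _ /(_ (f n x))] := fP n.
  by move=> /= fnx; rewrite /u fnx ?divr_gt0//; exists x.
apply: contra_neqP => nUx.
suff -> : range (u^~ x) = [set 0] by rewrite sup1.
have u0 n : u n x = 0.
  by rewrite /u; have [_ _ /(_ (f n x)) -> //] := fP n; rewrite ?mul0r//; exists x.
by apply/seteqP; split => [_ [n _ <-]|_ ->]; [exact: u0|exists 0].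
Qed.

End CozeroSets.

(** * Multiplication by conjugates and F-spaces *)

Section LocalMultiplication.
Local Open Scope complex_scope.
Variable R : realType.

Lemma bounded_setTP (T : Type) (f : T -> R) :
  [bounded f x | x in [set: T]] <-> exists M, forall x, `|f x| <= M.
Proof.
split=> [/pinfty_ex_gt0[M _ fM]|[M fM]]; first by exists M => x; exact: fM.
exists M; split=> [|N MN x _]; first exact: num_real.
by rewrite /= (le_trans (fM x))// ltW.
Qed.

(** The multiplier of [f] is [g (k1 + i k2)], where [k1] and [k2] extend the
    real and imaginary parts of [conj f / f] from the cozero-set of [f] to
    [U]; at the zeros of [f] both sides of the equation vanish. *)
Lemma F_space_local_multiplication (X : topologicalType) (U : set X)
    (g : CC R X) :
  open U -> (forall x, ~ U x -> g x = 0) -> F_space R U ->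
  local_multiplication (mul_conj g).
Proof.
move=> oU g0 [_ _ extU] f.
have cfU : continuous (fun s : U => f (set_val s) : R[i]^o).
  move=> s; apply: (continuous_comp (@initial_continuous U X set_val s)).
  exact: (@cts_fun _ _ f).
pose fU : CC R U := mkcts cfU.
pose A : set U := [set s | fU s != 0].
have cozA : cozero_set R A by exists fU.
have cfA : continuous (fun s : A => fU (set_val s) : R[i]^o).
  move=> s; apply: (continuous_comp (@initial_continuous A U set_val s)).
  exact: (@cts_fun _ _ fU).
pose fA : CC R A := mkcts cfA.
have fA0 s : fA s != 0 by exact: (set_mem (valP s)).
pose q (s : A) : R[i]^o := conjc (fA s) / fA s.
have cq : continuous q := continuous_conj_div fA0.
have q1 s : `|q s| = 1.
  by rewrite normf_div normcJ divff// normr_eq0.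
have extend (h : A -> R) : continuous h -> (forall s, `|h s| <= 1) ->
    exists k : U -> R, [/\ continuous k, exists M, forall s, `|k s| <= M &
      forall a : A, k (set_val a) = h a].
  move=> ch h1; have [|k bk kh] := extU A cozA (mkcts ch).
    by apply/bounded_setTP; exists 1.
  exists k; split => //; first exact: cts_fun.
  exact/bounded_setTP.
have [|k1 [ck1 bk1 k1q]] := extend _ (continuous_Re cq).
  by move=> s; rewrite -lecR (le_trans (normc_ge_Re _))// q1.
have [|k2 [ck2 bk2 k2q]] := extend _ (continuous_Im cq).
  by move=> s; rewrite -lecR (le_trans (normc_ge_Im _))// q1.
have glue (G : X -> R) (k : U -> R) : continuous G ->
    (forall x, g x = 0 -> G x = 0) -> continuous k ->
    (exists M, forall s, `|k s| <= M) ->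
    continuous (fun x => G x * 'valL_0 k x).
  move=> cG gG ck [M kM]; apply: (mul_valL_continuous oU cG _ ck kM).
  by move=> x /g0; exact: gG.
have cRg := continuous_Re (@cts_fun _ _ g).
have cIg := continuous_Im (@cts_fun _ _ g).
have Rg0 x : g x = 0 -> complex.Re (g x) = 0 by move=> ->.
have Ig0 x : g x = 0 -> complex.Im (g x) = 0 by move=> ->.
pose a x : R[i]^o := g x * ('valL_0 k1 x +i* 'valL_0 k2 x).
have ca : continuous a.
  have -> : a = fun x =>
      (complex.Re (g x) * 'valL_0 k1 x - complex.Im (g x) * 'valL_0 k2 x) +i*
      (complex.Re (g x) * 'valL_0 k2 x + complex.Im (g x) * 'valL_0 k1 x).
    by apply/funext => x; rewrite /a; case: (g x).
  apply: continuous_complex => x.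
    by apply: cvgB; apply: glue.
  by apply: cvgD; apply: glue.
exists (mkcts ca) => x.
change (g x * conjc (f x) = g x * ('valL_0 k1 x +i* 'valL_0 k2 x) * f x).
have [Ux|/g0 ->] := pselect (U x); last by rewrite !mul0r.
have [->|fx0] := eqVneq (f x : R[i]) 0; first by rewrite conjc0 !mulr0.
pose s : U := exist _ x (mem_set Ux).
pose t : A := exist _ s (mem_set fx0).
have -> : x = set_val (set_val t) by [].
rewrite !valL_set_val k1q k2q -mulrA; congr (_ * _).
have -> : complex.Re (q t) +i* complex.Im (q t) = q t by case: (q t).
by rewrite /q divfK.
Qed.

(** The hypothesis says that [c] is the Cayley transform of [t].  The first
    equation inverts it, [t = Im c / (1 + Re c)]; the second one bounds the
    denominator below when [t] is bounded. *)
Lemma cayley_inv (c : R[i]) (t : R) : c * (1 -i* t) = 1 +i* t ->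
  complex.Im c = t * (1 + complex.Re c) /\
  (1 + complex.Re c) * (1 + t ^+ 2) = 2.
Proof.
case: c => a b; simpc => -[re im] /=.
have bE : b = t * (1 + a) by rewrite mulrDr mulr1 -{1}im; ring.
by split=> //; move: re; rewrite bE => re; rewrite -[2]/(1 + 1) -{3}re; ring.
Qed.

(** The test function is [f = G p (1 - i h)], where the cozero-set of [G] is
    [U] and that of [p] in [U] is [A].  Both [p] and [p h] are bounded, so that
    [G p] and [G p h] extend by [0] to the whole space. *)
Lemma local_multiplication_F_space (X : topologicalType) (g : CC R X) :
  completely_regular_space X -> hausdorff_space X ->
  local_multiplication (mul_conj g) -> F_space R [set x | g x != 0].
Proof.
move=> crX hX lmg.
split; [exact: completely_regular_set_type|exact: hausdorff_set_type|].
set U := [set x | g x != 0].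
have cozU : cozero_set R U by exists g.
have oU := cozero_set_open cozU.
have [G [cG _ UG]] := cozero_set_real cozU.
have G0 x : ~ U x -> G x = 0 by rewrite UG => /negP/negPn/eqP.
have GN0 x : U x -> G x != 0 by rewrite UG.
move=> A cozA h /bounded_setTP[M hM].
have oA := cozero_set_open cozA.
have [P [cP P0 AP]] := cozero_set_real cozA.
pose p (s : U) := Num.min (P s) 1.
have cp : continuous p.
  by move=> s; apply: continuous_min; [exact: cP|exact: cst_continuous].
have p01 s : 0 <= p s <= 1.
  by rewrite le_min P0 ler01/= ge_min lexx orbT.
have p0 s : ~ A s -> p s = 0.
  by rewrite AP => /negP/negPn/eqP Ps; rewrite /p Ps min_l.
have pN0 s : A s -> p s != 0.
  by rewrite AP => /= Ps; rewrite gt_eqF// lt_min ltr01 andbT lt_neqAle eq_sym Ps P0.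
pose ph s := p s * 'valL_0 h s.
have cph : continuous ph.
  exact: (mul_valL_continuous oA cp p0 (@cts_fun _ _ h) hM).
have phM s : `|ph s| <= `|M|.
  rewrite /ph normrM.
  have [As|/p0 ->] := pselect (A s); last by rewrite normr0 mul0r.
  rewrite -[s]/(set_val (exist _ s (mem_set As) : A)) valL_set_val.
  have /andP[ps0 ps1] := p01 s.
  by rewrite -[leRHS]mul1r ler_pM ?(ger0_norm ps0) ?(le_trans (hM _)) ?ler_norm.
have cu : continuous (fun x => G x * 'valL_0 p x).
  apply: (mul_valL_continuous (M := 1) oU cG G0 cp) => s.
  by have /andP[ps0 ps1] := p01 s; rewrite ger0_norm.
have cv : continuous (fun x => - (G x * 'valL_0 ph x)).
  by move=> x; apply: cvgN; exact: (mul_valL_continuous oU cG G0 cph phM).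
have [a af] : exists a : CC R X, forall x,
    g x * conjc (G x * 'valL_0 p x -i* (G x * 'valL_0 ph x)) =
    a x * (G x * 'valL_0 p x -i* (G x * 'valL_0 ph x)).
  exact: (lmg (mkcts (continuous_complex cu cv))).
pose c (s : U) : R[i]^o := a (set_val s) / g (set_val s).
have cc : continuous c.
  have restr (b : CC R X) : continuous (fun s : U => b (set_val s) : R[i]^o).
    move=> s; apply: (continuous_comp (@initial_continuous U X set_val s)).
    exact: (@cts_fun _ _ b).
  move=> s; apply: (@cvgM R[i] U (nbhs s) _ (fun s => a (set_val s))
    (fun s => (g (set_val s))^-1)); first exact: restr.
  by apply: (@cvgV R[i]); [exact: (set_mem (valP s))|exact: restr].
have cA (s : A) : c (set_val s) * (1 -i* h s) = 1 +i* h s.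
  pose x := set_val (set_val s).
  have Ux : U x by exact: (set_mem (valP (set_val s))).
  have ps0 : p (set_val s) != 0 by apply: pN0; exact: (set_mem (valP s)).
  have := af x; rewrite !valL_set_val /ph valL_set_val.
  have fE (r w t : R) : r * w -i* (r * (w * t)) = (r * w)%:C * (1 -i* t).
    by simpc; rewrite mulrA.
  have conj_fE (r w t : R) :
      conjc (r * w -i* (r * (w * t))) = (r * w)%:C * (1 +i* t).
    by simpc; rewrite mulrA.
  rewrite conj_fE fE.
  have w0 : (G x * p (set_val s))%:C != 0 :> R[i].
    by rewrite eq_complex /= eqxx andbT mulf_neq0// GN0.
  rewrite mulrCA [in RHS]mulrCA => /(mulfI w0) ga.
  by rewrite /c mulrAC -ga mulrC mulKf.
have cRc := continuous_Re cc.
have cIc := continuous_Im cc.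
(* the least value of [1 + Re c] allowed by [cayley_inv] when [|h| <= M] *)
pose d : R := 2 / (1 + M ^+ 2).
have d0 : 0 < d by rewrite divr_gt0// ltr_wpDr// sqr_ge0.
pose m (s : U) := Num.max (1 + complex.Re (c s)) d.
have cm : continuous m.
  move=> s; apply: (@continuous_max _ _ (fun s => 1 + complex.Re (c s)) (fun=> d)).
    apply: (@cvgD R R^o U (nbhs s) _ (fun=> 1) (fun s => complex.Re (c s))).
      exact: cst_continuous.
    exact: cRc.
  exact: cst_continuous.
pose r (s : U) := complex.Im (c s) / m s.
have cr : continuous r.
  move=> s; apply: (@cvgM R U (nbhs s) _ (fun s => complex.Im (c s))
    (fun s => (m s)^-1)); first exact: cIc.
  by apply: cvgV; [rewrite gt_eqF// lt_max d0 orbT|exact: cm].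
(* off [A] nothing bounds [r], hence the truncation *)
pose k (s : U) := Num.max (- M) (Num.min M (r s)).
have ck : continuous k.
  move=> s; apply: (@continuous_max _ _ (fun=> - M) (fun s => Num.min M (r s))).
    exact: cst_continuous.
  apply: (@continuous_min _ _ (fun=> M) r); last exact: cr.
  exact: cst_continuous.
exists (mkcts ck).
  apply/bounded_setTP; exists `|M| => s; rewrite /= ler_norml.
  have nM := ler_norm M; have nNM := ler_norm (- M); rewrite normrN in nNM.
  by rewrite /k le_max ge_max ge_min nM nNM lerN2 nM.
move=> s; rewrite -[LHS]/(k (set_val s)) /k /r /m.
have [Im_c Re_c] := cayley_inv (cA s).
have := hM s; rewrite ler_norml => /andP[hNM hleM].
have t0 : 0 < 1 + h s ^+ 2 by rewrite ltr_wpDr// sqr_ge0.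
have Re_cE : 1 + complex.Re (c (set_val s)) = 2 / (1 + h s ^+ 2).
  by rewrite -Re_c mulfK// gt_eqF.
have dle : d <= 1 + complex.Re (c (set_val s)).
  rewrite Re_cE ler_pM2l// lef_pV2 ?posrE// ?lerD2l; last first.
    by rewrite ltr_wpDr// sqr_ge0.
  by rewrite -real_normK ?num_real// lerXn2r ?nnegrE// (le_trans _ (hM s)).
rewrite (max_l dle) Im_c mulfK; last by rewrite gt_eqF// (lt_le_trans d0).
by rewrite (min_r hleM) (max_r hNM).
Qed.

End LocalMultiplication.

(** * The equivalence *)

Theorem theorem7 (R : realType) (X : topologicalType)
    (hausX : hausdorff_space X) (compX : compact [set: X]) :
  (exists g : CC R X,
     (g : X -> R[i]) <> (fun=> 0) /\ local_multiplication (mul_conj g)) <->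
  (exists U : set X, [/\ U !=set0, open U, Fsigma U & F_space R U]).
Proof.
have nX := compact_normal hausX compX.
split=> [[g [gN0 lmg]]|[U [[x0 Ux0] oU FU fsU]]].
  have cozU : cozero_set R [set x | g x != 0] by exists g.
  exists [set x | g x != 0]; split.
  - apply/set0P/eqP => g0; apply: gN0; apply/funext => x; apply/eqP.
    apply/negPn/negP => gx; have : [set x | g x != 0] x by [].
    by rewrite g0.
  - exact: cozero_set_open cozU.
  - exact: cozero_set_Fsigma cozU.
  - apply: local_multiplication_F_space => //.
    exact: (normal_completely_regular nX (hausdorff_accessible hausX)).
have [G cG UG] := open_Fsigma_cozero R nX oU FU.
have cg : continuous (fun x => (G x)%:C%C : R[i]^o).
  move=> x; exact: (continuous_comp (cG x) (@real_complex_continuous R _)).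
exists (mkcts cg); split.
  move=> /(congr1 (@^~ x0)) /= /complexI G0.
  by have := proj1 (UG x0) Ux0; rewrite G0 eqxx.
apply: (F_space_local_multiplication oU) => // x nUx.
have Gx : G x = 0 by apply/eqP/negPn/negP => /UG.
by rewrite -[LHS]/((G x)%:C%C) Gx.
Qed.
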